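(* A discrete group $\Gamma$ has a zipper action if and only if $\Gamma$ acts properly on a space with walls.
   Context: A discrete group $\Gamma$ has a zipper action if there is a left action of $\Gamma$ on a set $\mathcal E$ and a subset $Z\subseteq\mathcal E$ such that (1) for every $g\in\Gamma$, the symmetric difference $gZ\,\triangle\,Z$ is finite, and (2) for every $r>0$, the set $\{g\in\Gamma : |gZ\,\triangle\,Z|\le r\}$ is finite. Let $S$ be a set. A wall in $S$ is a pair $W=\{H_1,H_2\}$ that is a partition of $S$, i.e., $S=H_1\cup H_2$, $H_1\cap H_2=\emptyset$, and $H_1\ne\emptyset\ne H_2$; $H_1$ and $H_2$ are called half-spaces in $S$. Elements $x,y\in S$ are separated by $W$ if one of them lies in $H_1$ and the other in $H_2$. The set $S$ is a space with walls if there is given a set of walls in $S$ such that for every $x,y\in S$ there are at most finitely many (given) walls separating $x$ and $y$; in this case $d(x,y)$ is defined to be the number of (given) walls separating $x$ and $y$, and $d$ is a pseudometric (that is, it is symmetric and satisfies the triangle inequality). A group $\Gamma$ acts on the space $S$ with walls if there is an action of $\Gamma$ on $S$ such that $\Gamma$ permutes the walls; in this case the action is by isometries of the pseudometric. The group $\Gamma$ is said to act properly on the space $S$ with walls if for all $r\in\mathbb R$ and for all $p\in S$, the set $\{g\in\Gamma : d(gp,p)<r\}$ is finite. *)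

(* Defs.v *)
From mathcomp Require Import all_boot all_order all_algebra.
From mathcomp Require Import finmap boolp classical_sets functions cardinality.
From mathcomp Require Import reals.

Set Implicit Arguments.
Unset Strict Implicit.
Unset Printing Implicit Defensive.

Local Open Scope classical_set_scope.
Local Open Scope ring_scope.

(* The number of elements of a finite set; the junk value 0 if A is infinite. *)
Definition card (T : Type) (A : set T) : nat :=
  #|` fset_set (A : set {classic T})|%fset.

Record left_action (G : groupType) (X : Type) := LeftAction {
  act :> G -> X -> X;
  act1 : forall x, act 1%g x = x;
  actM : forall g h x, act (g * h)%g x = act g (act h x) }.

Definition has_zipper_action (R : realType) (G : groupType) : Prop :=
  exists (E : Type) (a : left_action G E) (Z : set E),
    (forall g : G, finite_set ((a g @` Z) `+` Z)) /\
    (forall r : R, 0 < r ->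
       finite_set [set g : G | (card ((a g @` Z) `+` Z))%:R <= r]).

(* A wall is the unordered pair of its two half-spaces. *)
Definition is_wall (S : Type) (W : set (set S)) : Prop :=
  exists H1 H2 : set S,
    [/\ W = [set H1; H2], [set: S] = H1 `|` H2, H1 `&` H2 = set0,
        H1 !=set0 & H2 !=set0].

(* Symmetric in x and y, because [set H1; H2] = [set H2; H1]. *)
Definition separates (S : Type) (W : set (set S)) (x y : S) : Prop :=
  exists H1 H2 : set S, [/\ W = [set H1; H2], H1 x & H2 y].

Record wall_space := WallSpace {
  points :> Type;
  walls : set (set (set points));
  walls_is_wall : forall W, walls W -> is_wall W;
  finite_separating : forall x y : points,
    finite_set [set W | walls W /\ separates W x y] }.

Definition wall_dist (S : wall_space) (x y : S) : nat :=
  card [set W | walls W /\ separates W x y].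

Definition permutes_walls (G : groupType) (S : wall_space)
    (a : left_action G S) : Prop :=
  forall g : G,
    set_bij (@walls S) (@walls S) (fun W => [set a g @` H | H in W]).

Definition proper_action (R : realType) (G : groupType) (S : wall_space)
    (a : left_action G S) : Prop :=
  forall (r : R) (p : S), finite_set [set g : G | (wall_dist (a g p) p)%:R < r].

(* The space is required to be nonempty: every group acts on the empty space
   with walls, and properness is then vacuous. *)
Definition acts_properly_on_wall_space (R : realType) (G : groupType) : Prop :=
  exists (S : wall_space) (a : left_action G S),
    [/\ [set: S] !=set0, permutes_walls a & proper_action R a].

(* Main.v *)
From Pilot Require Import Defs.
From mathcomp Require Import all_boot all_order all_algebra.
From mathcomp Require Import finmap boolp classical_sets functions cardinality.
From mathcomp Require Import reals.

(** Both directions rest on one correspondence: the elements of the set carrying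
    a zipper are half-spaces, and the zipper records on which side of each wall
    a chosen point lies, so that symmetric differences of zippers correspond to
    walls separating points.

    From walls to zippers, fix a point [p] and let the group act on all subsets
    of the space by taking images.  The zipper is the set of half-spaces that
    contain [p].  Its translate by [g] is the set of half-spaces containing
    [g p] ([image_halfspaces_at]), so the symmetric difference is the union of
    the walls separating [g p] from [p] ([sym_diff_halfspaces_at]).  It is
    finite, and at least as large as the set of those walls
    ([wall_dist_le_halfspaces]).

    From zippers to walls, the points of the space are the subsets [A] of [E]
    with [A `+` Z] finite, which the group permutes because [g Z `+` Z] is
    finite.  Each [e : E] cuts this space into the [A] that contain [e] and the
    [A] that do not.  The orbit of [Z] alone would carry walls too, but there
    distinct [e] may define the same wall or none at all, and a set of walls has
    no multiplicities.  In the larger space distinct [e] define distinct walls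
    ([coord_wall_inj]), so the number of walls separating [A] and [B] is at
    least that of [A `+` B] ([card_sym_diff_le_wall_dist]).  Properness at [A]
    follows, since [g Z `+` Z] is contained in the union of [g A `+` A],
    [g (A `+` Z)] and [A `+` Z] ([card_translate_le]). *)

Set Implicit Arguments.
Unset Strict Implicit.
Unset Printing Implicit Defensive.

Import Order.TTheory GRing.Theory Num.Theory.
(* This makes [card] the cardinal of a set again, not that of a finite type. *)
Import Pilot.Defs.

Local Open Scope classical_set_scope.
Local Open Scope card_scope.

(** * Cardinality of finite sets *)

Lemma card_le_mono (T U : Type) (A : set T) (B : set U) :
  finite_set B -> A #<= B -> (card A <= card B)%N.
Proof.
move=> /finite_setP[n Bn] AB.
rewrite /card (@card_fset_set {classic U} B n Bn).
by apply: (@geq_card_fset_set {classic T}); rewrite -(card_le_eqr Bn).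
Qed.

Lemma card_setU_le (T : Type) (A B : set T) :
  finite_set A -> finite_set B -> (card (A `|` B) <= card A + card B)%N.
Proof.
move=> fA fB; rewrite /card (@fset_setU {classic T})//.
exact: leq_card_fsetU.
Qed.

(** * Actions *)

Section Actions.
Variables (G : groupType) (X : Type) (a : left_action G X).

Lemma actKV g : cancel (a g^-1%g) (a g).
Proof. by move=> x; rewrite -actM mulgV act1. Qed.

Lemma actK g : cancel (a g) (a g^-1%g).
Proof. by move=> x; rewrite -actM mulVg act1. Qed.

Lemma act_image1 (A : set X) : a 1%g @` A = A.
Proof. by under eq_imagel do rewrite act1; rewrite image_id. Qed.

Lemma act_imageM g h (A : set X) : a (g * h)%g @` A = a g @` (a h @` A).
Proof. by rewrite image_comp; apply: eq_imagel => x _; rewrite actM. Qed.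

Definition set_action : left_action G (set X) :=
  @LeftAction G (set X) (fun g A => a g @` A) act_image1 act_imageM.

Lemma act_imageE g (A : set X) : a g @` A = a g^-1%g @^-1` A.
Proof.
apply/seteqP; split=> [_ [y Ay <-]|x Ax]; first by rewrite /preimage/= actK.
by exists (a g^-1%g x); rewrite ?actKV.
Qed.

End Actions.

(** * Walls and half-spaces *)

Definition wall_of (S : Type) (H : set S) : set (set S) := [set H; ~` H].

Lemma wall_of_mem (S : Type) (W : set (set S)) H :
  is_wall W -> W H -> W = wall_of H.
Proof.
move=> [H1 [H2 [-> cov dis _ _]]].
have H2E : H2 = ~` H1.
  apply/seteqP; split=> x.
    by move=> H2x H1x; have : (H1 `&` H2) x by []; rewrite dis.
  by move=> nH1x; have : [set: S] x by []; rewrite cov => -[].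
by rewrite {}H2E /wall_of => -[->|->] //; rewrite setCK setUC.
Qed.

Lemma separates_wall_of (S : Type) (H : set S) x y :
  separates (wall_of H) x y <-> (H x /\ ~ H y) \/ (H y /\ ~ H x).
Proof.
split.
  move=> [H1 [H2 [E H1x H2y]]].
  have [m1 m2] : wall_of H H1 /\ wall_of H H2 by rewrite E; split; [left|right].
  have [M N] : [set H1; H2] H /\ [set H1; H2] (~` H).
    by rewrite -E; split; [left|right].
  (* H1 = H2 would force H and its complement to be the same set. *)
  have neq : H <> ~` H.
    move=> /(congr1 (fun K : set S => K x))/=; case: (pselect (H x)) => h e.
      by have := h; rewrite {1}e; apply.
    by apply: (h); rewrite e.
  move: M N H1x H2y; case: m1 => ->; case: m2 => -> M N Hx Hy.
  - by exfalso; apply: neq; case: N.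
  - by left.
  - by right.
  - by exfalso; apply: neq; case: M.
move=> [[Hx Hy]|[Hy Hx]]; first by exists H, (~` H).
by exists (~` H), H; rewrite /wall_of setUC.
Qed.

Lemma act_wall_of (G : groupType) (X : Type) (a : left_action G X) g H :
  set_action (set_action a) g (wall_of H) = wall_of (set_action a g H).
Proof.
rewrite /wall_of /= image_setU !image_set1; congr (_ `|` [set _]).
by rewrite !act_imageE preimage_setC.
Qed.

(** Group translations are invertible, so a family of walls stable under every
    translation is permuted by each of them. *)
Lemma permutes_walls_stable (G : groupType) (S : wall_space)
    (a : left_action G S) :
  (forall g W, walls W -> walls (set_action (set_action a) g W)) ->
  permutes_walls a.
Proof.
move=> st g; split.
- by move=> W; exact: st.
- by apply: in2W; exact: can_inj (actK (set_action (set_action a)) g).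
- move=> W wW; exists (set_action (set_action a) g^-1%g W); first exact: st.
  exact: (actKV (set_action (set_action a))).
Qed.

(** * From walls to zippers *)

Section WallsToZipper.
Variables (G : groupType) (S : wall_space) (a : left_action G S).

Definition halfspaces_at (p : S) : set (set S) :=
  [set H | (exists2 W, walls W & W H) /\ H p].

Lemma image_halfspaces_at g p : permutes_walls a ->
  set_action a g @` halfspaces_at p = halfspaces_at (a g p).
Proof.
move=> perm; apply/seteqP; split=> H.
  move=> [K [[W wW WK] Kp] <-]; split; last by exists p.
  exists (set_action (set_action a) g W); last by exists K.
  by have [+ _ _] := perm g; apply.
move=> [[W wW WH] Hgp]; rewrite act_imageE; split; last first.
  by exists (a g p); rewrite ?actK.
exists (set_action (set_action a) g^-1%g W); last by exists H.
by have [+ _ _] := perm g^-1%g; apply.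
Qed.

(** A half-space contains exactly one of two points precisely when its wall
    separates them; both sides of a separating wall have this property. *)
Lemma sym_diff_halfspaces_at x y :
  halfspaces_at x `+` halfspaces_at y =
  \bigcup_(W in [set W | walls W /\ separates W x y]) W.
Proof.
apply/seteqP; split=> H.
  move=> D; have [W wW WH] : exists2 W, walls W & W H by case: D => -[[]].
  exists W => //; split=> //.
  rewrite (wall_of_mem (walls_is_wall wW) WH); apply/separates_wall_of.
  case: D => -[[_ h1] h2]; [left|right]; split=> // h;
    by apply: h2; split=> //; exists W.
move=> [W [wW sW] WH]; move: sW.
rewrite (wall_of_mem (walls_is_wall wW) WH) => /separates_wall_of.
move=> [[h1 h2]|[h1 h2]]; [left|right]; split=> //;
  by [split=> //; exists W|case].
Qed.

Lemma finite_sym_diff_halfspaces_at x y :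
  finite_set (halfspaces_at x `+` halfspaces_at y).
Proof.
rewrite sym_diff_halfspaces_at; apply: bigcup_finite.
  exact: finite_separating.
by move=> W [/walls_is_wall[H1 [H2 [-> _ _ _ _]]] _]; exact: finite_set2.
Qed.

(** Each separating wall is recovered from either of its half-spaces. *)
Lemma wall_dist_le_halfspaces x y :
  (wall_dist x y <= card (halfspaces_at x `+` halfspaces_at y))%N.
Proof.
apply: card_le_mono; first exact: finite_sym_diff_halfspaces_at.
apply: card_le_trans (card_image_le (@wall_of S) _).
apply: subset_card_le => W [wW sW].
have [H1 [H2 [WE H1x H2y]]] := sW.
have WH1 : W H1 by rewrite WE; left.
exists H1; last by rewrite -(wall_of_mem (walls_is_wall wW) WH1).
by rewrite sym_diff_halfspaces_at; exists W.
Qed.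

Lemma zipper_of_walls (R : realType) :
  [set: S] !=set0 -> permutes_walls a -> proper_action R a ->
  has_zipper_action R G.
Proof.
move=> [p _] perm prop; exists (set S), (set_action a), (halfspaces_at p).
split=> [g|r _].
  by rewrite image_halfspaces_at//; exact: finite_sym_diff_halfspaces_at.
apply: sub_finite_set (prop (r + 1)%R p) => g /=.
rewrite image_halfspaces_at// => le_r.
apply: (@le_lt_trans _ _ r); last by rewrite ltrDl ltr01.
by apply: le_trans le_r; rewrite ler_nat wall_dist_le_halfspaces.
Qed.

End WallsToZipper.

(** * From zippers to walls *)

Section ZipperToWalls.
Variables (E : Type) (Z : set E).

Definition commensurate := {A : set E | finite_set (A `+` Z)}.

Definition Commensurate A (fA : finite_set (A `+` Z)) : commensurate :=
  exist _ A fA.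

Definition coord (e : E) : set commensurate := [set A | sval A e].

Definition coord_walls : set (set (set commensurate)) :=
  [set wall_of (coord e) | e in [set: E]].

Lemma finite_sym_diff_sub (A B C : set E) :
  finite_set (A `+` C) -> finite_set (B `+` C) -> finite_set (A `+` B).
Proof.
move=> fA fB; apply: (@sub_finite_set _ _ ((A `+` C) `|` (B `+` C))).
  by move=> x /=; case: (pselect (C x)); tauto.
by rewrite finite_setU.
Qed.

Lemma commensurate_setU (F : set E) :
  finite_set F -> finite_set ((Z `|` F) `+` Z).
Proof. by apply: sub_finite_set => x /=; tauto. Qed.

Lemma commensurate_setD (F : set E) :
  finite_set F -> finite_set ((Z `\` F) `+` Z).
Proof. by apply: sub_finite_set => x /=; case: (pselect (F x)); tauto. Qed.

Lemma commensurate_set_swap e e' :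
  finite_set (((Z `|` [set e]) `\` [set e']) `+` Z).
Proof.
apply: (@sub_finite_set _ _ [set e; e']); last exact: finite_set2.
by move=> x /=; case: (pselect (x = e')); tauto.
Qed.

Lemma coord_wall_is_wall e : is_wall (wall_of (coord e)).
Proof.
exists (coord e), (~` coord e); split=> //; rewrite ?setUv ?setICr//.
  by exists (Commensurate (commensurate_setU (finite_set1 e))); right.
by exists (Commensurate (commensurate_setD (finite_set1 e))) => -[_]; apply.
Qed.

(** Among the commensurate sets, one contains [e] but not [e'], so the two
    coordinates differ; another contains both, so they are not complementary. *)
Lemma coord_wall_inj : injective (fun e => wall_of (coord e)).
Proof.
move=> e e' eqW; apply: contrapT => ne.
have : wall_of (coord e') (coord e) by rewrite -eqW; left.
case=> eqc.
  pose A := Commensurate (commensurate_set_swap e e').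
  have : coord e A by split=> /=; [right|exact: ne].
  by rewrite eqc => -[_]; apply.
pose A := Commensurate (commensurate_setU (finite_set2 e e')).
have : coord e A by right; left.
by rewrite eqc; apply; right; right.
Qed.

Lemma coord_separating (A B : commensurate) :
  [set W | coord_walls W /\ separates W A B] =
  [set wall_of (coord e) | e in sval A `+` sval B].
Proof.
apply/seteqP; split=> W.
  by move=> [[e _ <-]] /separates_wall_of AB; exists e.
by move=> [e AB <-]; split; [exists e|apply/separates_wall_of].
Qed.

Lemma coord_finite_separating (A B : commensurate) :
  finite_set [set W | coord_walls W /\ separates W A B].
Proof.
rewrite coord_separating; apply: finite_image.
exact: finite_sym_diff_sub (svalP A) (svalP B).
Qed.

Lemma coord_walls_is_wall W : coord_walls W -> is_wall W.
Proof. by move=> [e _ <-]; exact: coord_wall_is_wall. Qed.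

Definition commensurate_space : wall_space :=
  WallSpace coord_walls_is_wall coord_finite_separating.

Lemma card_sym_diff_le_wall_dist (A B : commensurate_space) :
  (card (sval A `+` sval B) <= wall_dist A B)%N.
Proof.
apply: card_le_mono; first exact: coord_finite_separating.
have -> := coord_separating A B.
by rewrite (card_le_eqr (inj_card_eq (in2W coord_wall_inj))).
Qed.

Variables (G : groupType) (a : left_action G E).
Hypothesis finZ : forall g, finite_set ((a g @` Z) `+` Z).

Lemma act_sym_diff g (A B : set E) :
  a g @` (A `+` B) = (a g @` A) `+` (a g @` B).
Proof. by rewrite !act_imageE. Qed.

Lemma commensurate_act g (A : commensurate) :
  finite_set ((a g @` sval A) `+` Z).
Proof.
apply: (@finite_sym_diff_sub _ _ (a g @` Z)); last by rewrite setYC.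
by rewrite -act_sym_diff; exact: finite_image (svalP A).
Qed.

Definition commensurate_map g (A : commensurate) : commensurate :=
  Commensurate (commensurate_act g A).

Lemma commensurate_map1 A : commensurate_map 1%g A = A.
Proof. by case: A => A fA; apply: eq_exist; exact: act_image1. Qed.

Lemma commensurate_mapM g h A :
  commensurate_map (g * h)%g A = commensurate_map g (commensurate_map h A).
Proof. by apply: eq_exist; exact: act_imageM. Qed.

Definition commensurate_action : left_action G commensurate_space :=
  @LeftAction G commensurate_space _ commensurate_map1 commensurate_mapM.

Lemma act_coord g e : set_action commensurate_action g (coord e) = coord (a g e).
Proof.
rewrite [LHS](act_imageE commensurate_action); apply/seteqP; split=> A.
  by move=> [x Ax <-]; rewrite /coord/= actKV.
by move=> Aae; exists (a g e); rewrite ?actK.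
Qed.

Lemma commensurate_permutes_walls : permutes_walls commensurate_action.
Proof.
apply: permutes_walls_stable => g _ [e _ <-]; exists (a g e) => //.
by rewrite -act_coord act_wall_of.
Qed.

(** Going from [g Z] to [Z] through [g A] and [A] costs the distance travelled
    by [A] and twice the size of [A `+` Z], since translating by [g] does not
    enlarge [A `+` Z]; the error term is thus independent of [g]. *)
Lemma card_translate_le g (A : commensurate_space) :
  (card ((a g @` Z) `+` Z) <=
     wall_dist (commensurate_action g A) A + (card (sval A `+` Z)).*2)%N.
Proof.
have fA := svalP A; have fgA := finite_image (a g) fA.
have fD : finite_set (sval (commensurate_action g A) `+` sval A).
  exact: finite_sym_diff_sub (svalP (commensurate_action g A)) fA.
set D := _ `+` sval A in fD.
have fU : finite_set ((a g @` (sval A `+` Z)) `|` (sval A `+` Z)).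
  by rewrite finite_setU.
apply: (@leq_trans (card (D `|` ((a g @` (sval A `+` Z)) `|` (sval A `+` Z))))).
  apply: card_le_mono; first by rewrite finite_setU.
  apply: subset_card_le => x; rewrite act_sym_diff /D /=.
  by case: (pselect (sval A x)); case: (pselect ((a g @` sval A) x)) => /=; tauto.
apply: (leq_trans (card_setU_le fD fU)); apply: leq_add.
  exact: card_sym_diff_le_wall_dist.
apply: (leq_trans (card_setU_le fgA fA)); rewrite -addnn leq_add2r.
by apply: card_le_mono => //; exact: card_image_le.
Qed.

Lemma walls_of_zipper (R : realType) :
  (forall r : R, (0 < r)%R ->
     finite_set [set g : G | ((card ((a g @` Z) `+` Z))%:R <= r)%R]) ->
  acts_properly_on_wall_space R G.
Proof.
move=> prop; exists commensurate_space, commensurate_action; split.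
- have fZ : finite_set (Z `+` Z) by rewrite setYK; exact: finite_set0.
  by exists (Commensurate fZ).
- exact: commensurate_permutes_walls.
move=> r A; have [r0|r0] := leP r 0%R.
  apply: (@sub_finite_set _ _ set0) => // g /= lt_r.
  by have := lt_le_trans lt_r r0; rewrite ltNge ler0n.
apply: sub_finite_set (prop (r + (card (sval A `+` Z)).*2%:R)%R _) => [g /= lt_r|].
  apply: le_trans (_ : (_ <= (wall_dist (commensurate_action g A) A
                              + (card (sval A `+` Z)).*2)%:R)%R) _.
    by rewrite ler_nat card_translate_le.
  by rewrite natrD lerD2r ltW.
by rewrite ltr_wpDr// ler0n.
Qed.

End ZipperToWalls.

Theorem theoremA1 (R : realType) (Gamma : groupType) :
  has_zipper_action R Gamma <-> acts_properly_on_wall_space R Gamma.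
Proof.
split; first by move=> [E [a [Z [finZ prop]]]]; exact: walls_of_zipper finZ _ prop.
by move=> [S [a [ne perm prop]]]; exact: zipper_of_walls ne perm prop.
Qed.
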